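(* For all integers $r\ge 3$ and $t$ with $1\le t\le r-2$, there exists an integer $n(r,t)$ such that for every $n\ge n(r,t)$, $$\iota_0(t,n;r)=\max\left\{n^{r-t}-(n-1)^{r-t}+t(n-1),\ (t+2)n^{r-t-1}-(t+1)n^{r-t-2}\right\}.$$
   Context: Let $X_\ell=[n_\ell]$ for $1\le\ell\le r$. For $A,B\in X_1\times\dots\times X_r$, write $A\cap B=\{\ell\in[r]:A[\ell]=B[\ell]\}$, where $A[\ell]$ is the $\ell$-th coordinate. A family $\mathcal F\subseteq X_1\times\dots\times X_r$ is $t$-intersecting if $|A\cap B|\ge t$ for all $A,B\in\mathcal F$. Let $\bigcap\mathcal F=\{\ell\in[r]:\text{all members of }\mathcal F\text{ have the same }\ell\text{-th coordinate}\}$. A $t$-intersecting family is non-trivial if $|\bigcap\mathcal F|<t$. For integers $r>t\ge1$ and $n_1\ge\dots\ge n_r\ge 2$, $\iota_0(t,n_1,\dots,n_r)$ denotes the maximum size of a non-trivial $t$-intersecting family $\mathcal F\subseteq X_1\times\dots\times X_r$, and $\iota_0(t,n;r)=\iota_0(t,n,\dots,n)$ with $r$ entries equal to $n$. *)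

(* Defs.v *)
From mathcomp Require Import all_boot.
Set Implicit Arguments. Unset Strict Implicit. Unset Printing Implicit Defensive.

(* Elements of X_1 x ... x X_r with X_l = [n] are modelled as functions
   'I_r -> 'I_n (coordinates indexed 0..r-1, values 0..n-1). *)
Definition vec (r n : nat) := {ffun 'I_r -> 'I_n}.

Definition agree (r n : nat) (A B : vec r n) : {set 'I_r} :=
  [set l | A l == B l].

Definition t_intersecting (r n t : nat) (F : {set vec r n}) : bool :=
  [forall A in F, forall B in F, t <= #|agree A B|].

Definition bigcapF (r n : nat) (F : {set vec r n}) : {set 'I_r} :=
  [set l | [forall A in F, forall B in F, A l == B l]].

Definition nontrivial_t_intersecting (r n t : nat) (F : {set vec r n}) : bool :=
  t_intersecting t F && (#|bigcapF F| < t).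

Definition iota0 (t n r : nat) : nat :=
  \max_(F : {set vec r n} | nontrivial_t_intersecting t F) #|F|.

(* Main.v *)
Require Import Defs.
From mathcomp Require Import all_boot zify.

(** A vector is identified with its set of cells [(l, A l)].  Let [k = r - t], let [F] be
    a largest non-trivial t-intersecting family, and call kernel a set of [t + 1]
    cells of a member of [F] that meets every member of [F] in at least [t] cells.
    Branching on the cells of a member of [F] that meets the current partial vector
    too little shows that all but [O(n^(k-2))] members of [F] contain a kernel, so
    [|F| <= g n^(k-1) + O(n^(k-2))] for [g] kernels; if [g < k], then for large [n]
    this is below [n^k - (n-1)^k].
    If [g >= k], maximality makes the kernels pairwise t-intersecting.  Either three
    of them span a set of [t + 2] cells, and then each member of [F] contains at least
    [t + 1] of these cells; or they all share the same [t] cells, and then their union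
    is a full vector and [F] lies in a Hilton-Milner family. *)

Set Implicit Arguments. Unset Strict Implicit. Unset Printing Implicit Defensive.

(** * Sizes of the Hilton-Milner and Frankl families *)

(** Serves both families: with [E = D] a vector errs once inside [E] and is free elsewhere; with
    [E = setT] it lies at Hamming distance one from [C]. *)
Definition one_diff (r n : nat) (C : vec r n) (E D : {set 'I_r}) : {set vec r n} :=
  [set A | [exists z in D, E :\: agree A C == [set z]]].

Definition hm_family (r n : nat) (C : vec r n) (D : {set 'I_r}) : {set vec r n} :=
  [set A | (D \subset agree A C) && (~: D :&: agree A C != set0)]
    :|: one_diff C setT D.

Definition frankl_family (r n : nat) (C : vec r n) (E : {set 'I_r}) : {set vec r n} :=
  [set A | E \subset agree A C] :|: one_diff C E E.

Lemma in_agree r n (A B : vec r n) l : (l \in agree A B) = (A l == B l).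
Proof. by rewrite inE. Qed.

Lemma card_box r n (P : 'I_r -> {set 'I_n}) :
  #|[set A : vec r n | [forall l, A l \in P l]]| = \prod_l #|P l|.
Proof.
transitivity #|family (fun l => mem (P l))|.
  by apply: eq_card => A; rewrite !inE; apply/forallP/familyP.
by rewrite card_family foldrE big_image.
Qed.

Lemma prod_const_in r (D : {set 'I_r}) a b :
  \prod_l (if l \in D then a else b) = a ^ #|D| * b ^ (r - #|D|).
Proof.
rewrite (bigID (mem D)) /= -(prod_nat_const (mem D)).
congr (_ * _); first by apply: eq_bigr => l ->.
have -> : r - #|D| = #|[predC mem D]|.
  have e : #|D| + #|[predC mem D]| = r by exact: etrans (cardC (mem D)) (card_ord r).
  by rewrite -[X in X - _]e addKn.
by rewrite -prod_nat_const; apply: eq_big => // l /negbTE ->.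
Qed.

Lemma card_agree_on r n (C : vec r n) (D : {set 'I_r}) :
  #|[set A | D \subset agree A C]| = n ^ (r - #|D|).
Proof.
rewrite -[RHS]mul1n -[X in X * _](exp1n #|D|) -(prod_const_in D).
transitivity (\prod_l #|(if l \in D then [set C l] else setT : {set 'I_n})|).
  rewrite -card_box; apply: eq_card => A; rewrite !inE.
  apply/subsetP/forallP => [H l|H l lD].
    by case: ifP => lD; [move: (H l lD)|]; rewrite !inE.
  by move: (H l); rewrite lD !inE.
by apply: eq_bigr => l _; case: ifP; rewrite ?cards1 // cardsT card_ord.
Qed.

Lemma card_differ_off r n (C : vec r n) (D : {set 'I_r}) :
  #|[set A | D == agree A C]| = (n - 1) ^ (r - #|D|).
Proof.
rewrite -[RHS]mul1n -[X in X * _](exp1n #|D|) -(prod_const_in D).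
transitivity (\prod_l #|(if l \in D then [set C l] else ~: [set C l])|).
  rewrite -card_box; apply: eq_card => A; rewrite !inE.
  apply/eqP/forallP => [-> l|H].
    by rewrite in_agree; case: ifP => [|/negbT]; rewrite !inE.
  apply/setP => l; move: (H l); rewrite in_agree.
  by case: ifP; rewrite !inE => // _ /negbTE.
by apply: eq_bigr => l _; case: ifP; rewrite ?cards1 // cardsC1 card_ord subn1.
Qed.

Lemma card_one_diff_at r n (C : vec r n) (E : {set 'I_r}) z : z \in E ->
  #|[set A | E :\: agree A C == [set z]]| = (n - 1) * n ^ (r - #|E|).
Proof.
move=> zE.
transitivity (\prod_l #|(if l == z then ~: [set C z] else
                         if l \in E then [set C l] else setT : {set 'I_n})|).
  rewrite -card_box; apply: eq_card => A; rewrite !inE.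
  apply/eqP/forallP => [H l|H].
    have := in_set1 l z; rewrite -H !inE => e.
    case: (eqVneq l z) e => [->|_]; first by rewrite !inE zE andbT => ->.
    by case: ifP => lE; rewrite !inE // andbT => /negbFE.
  apply/setP => l; move: (H l); rewrite !inE.
  case: (eqVneq l z) => [->|_]; first by rewrite !inE zE andbT.
  by case: ifP; rewrite !inE ?andbF // => _ ->.
rewrite (bigD1 z) //= eqxx cardsC1 card_ord subn1; congr (_ * _).
rewrite -[RHS]mul1n -[X in X * _](exp1n #|E|) -(prod_const_in E) [RHS](bigD1 z) //= zE mul1n.
by apply: eq_bigr => l /negbTE ->; case: ifP; rewrite ?cards1 // cardsT card_ord.
Qed.

(** The exceptional coordinate of a vector is unique, so its membership indicator is a sum of
    indicators over [D]; exchanging the sums reduces to [card_one_diff_at]. *)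
Lemma card_one_diff r n (C : vec r n) (E D : {set 'I_r}) : D \subset E ->
  #|one_diff C E D| = #|D| * ((n - 1) * n ^ (r - #|E|)).
Proof.
move=> /subsetP DE; rewrite -sum_nat_const.
transitivity (\sum_A \sum_(z in D) ((E :\: agree A C == [set z]) : nat)).
  rewrite -sum1_card big_mkcond /=; apply: eq_bigr => A _; rewrite inE.
  case: ifPn => [/existsP[z /andP[zD /eqP e]]|/existsPn H].
    rewrite (bigD1 z) //= e eqxx big1 // => y /andP[_ yz].
    by apply/eqP; rewrite eqb0; apply: contra yz => /eqP/set1_inj->.
  by rewrite big1 // => z zD; move: (H z); rewrite zD /= => /negbTE ->.
rewrite exchange_big /=; apply: eq_bigr => z zD.
rewrite -(card_one_diff_at C (DE _ zD)) -sum1_card [RHS]big_mkcond /=.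
by apply: eq_bigr => A _; rewrite inE; case: eqP.
Qed.

(** The two pieces are disjoint, and the first consists of the vectors agreeing with [C] on [D],
    minus those whose agreement set is exactly [D]. *)
Lemma card_hm_family r n (C : vec r n) (D : {set 'I_r}) :
  #|hm_family C D| = n ^ (r - #|D|) - (n - 1) ^ (r - #|D|) + #|D| * (n - 1).
Proof.
rewrite cardsU [X in _ - X](_ : _ = 0) ?subn0; last first.
  apply/eqP; rewrite cards_eq0; apply/eqP/setP => A; rewrite !inE.
  apply/negbTE/negP => /andP[/andP[/subsetP DA _] /existsP[z /andP[zD /eqP e]]].
  by have := set11 z; rewrite -e inE (DA _ zD).
rewrite card_one_diff ?subsetT // cardsT card_ord subnn muln1.
congr (_ + _); rewrite -(card_agree_on C) -(card_differ_off C).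
rewrite -(setID [set A | D \subset agree A C] [set A | D == agree A C]) cardsU.
rewrite [X in _ - X - _](_ : _ = 0) ?subn0; last first.
  by apply/eqP; rewrite cards_eq0; apply/eqP/setP => A; rewrite !inE; case: eqP => /=; rewrite ?andbF.
rewrite (_ : _ :&: _ = [set A | D == agree A C]); last first.
  by apply/setP => A; rewrite !inE; case: eqP => [->|]; rewrite ?subxx ?andbF.
rewrite addKn; apply: eq_card => A; rewrite !inE [in RHS]andbC.
case: (boolP (D \subset _)) => //= DA; rewrite [D == _]eqEsubset DA /=.
by rewrite setIC -setDE setD_eq0.
Qed.

Lemma card_frankl_family r n (C : vec r n) (E : {set 'I_r}) :
  #|frankl_family C E| = n ^ (r - #|E|) + #|E| * ((n - 1) * n ^ (r - #|E|)).
Proof.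
rewrite cardsU card_one_diff // card_agree_on.
rewrite [X in _ - X](_ : _ = 0) ?subn0 //.
apply/eqP; rewrite cards_eq0; apply/eqP/setP => A; rewrite !inE.
apply/negbTE/negP => /andP[/subsetP DA /existsP[z /andP[zD /eqP e]]].
by have := set11 z; rewrite -e inE (DA _ zD).
Qed.

(** * Lower bound: both families are non-trivial and t-intersecting *)

Lemma agreeI r n (A B C : vec r n) : agree A C :&: agree B C \subset agree A B.
Proof.
by apply/subsetP => l; rewrite !inE => /andP[/eqP -> /eqP ->].
Qed.

(** Changing [C] at the single coordinate [l] stays in the Hamming ball of radius one, so no
    coordinate is constant on [F]. *)
Lemma bigcapF_ball r n (C : vec r n) (F : {set vec r n}) : 1 < n ->
  (forall A z, ~: agree A C \subset [set z] -> A \in F) -> bigcapF F = set0.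
Proof.
move=> n1 H; apply/setP => l; rewrite !inE; apply/negbTE/negP => /forallP HF.
have [v vC] : exists v, v != C l.
  have : 0 < #|[set~ C l]| by rewrite cardsC1 card_ord; lia.
  by rewrite card_gt0 => /set0Pn[v]; rewrite !inE => ?; exists v.
pose A : vec r n := [ffun l' => if l' == l then v else C l'].
have AF : A \in F.
  apply: (H _ l); apply/subsetP => l'; rewrite !inE ffunE.
  by case: (l' == l) => //; rewrite eqxx.
have CF : C \in F by apply: (H _ l); apply/subsetP => l'; rewrite !inE eqxx.
move: (HF A); rewrite AF => /forallP/(_ C); rewrite CF /= ffunE eqxx.
by rewrite (negbTE vC).
Qed.

Lemma one_diff_subP r n (C A : vec r n) (E D : {set 'I_r}) :
  A \in one_diff C E D -> exists2 z, z \in D & E :\ z \subset agree A C.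
Proof.
rewrite inE => /existsP[z /andP[zD /eqP e]]; exists z => //.
apply/subsetP => l; rewrite in_setD1 => /andP[lz lE]; apply/negPn/negP => lA.
have : l \in E :\: agree A C by rewrite inE lA.
by rewrite e inE (negbTE lz).
Qed.

(** Threshold form of membership, handier than the disjoint union for intersection and containment
    arguments. *)
Lemma frankl_family_card_agree r n (C A : vec r n) (E : {set 'I_r}) :
  (A \in frankl_family C E) = (#|E| <= #|E :&: agree A C|.+1).
Proof.
have e := cardsID (agree A C) E.
rewrite inE [A \in [set _ | _]]inE; apply/orP/idP => [[]|].
- by move=> /setIidPl ->.
- rewrite inE => /existsP[z /andP[_ /eqP e']].
  by move: e; rewrite e' cards1; lia.
move=> h; have : #|E :\: agree A C| <= 1 by lia.
rewrite leq_eqVlt ltnS leqn0 cards_eq0 setD_eq0 => /orP[/cards1P[z ez]|]; last by left.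
right; rewrite inE; apply/existsP; exists z; rewrite ez eqxx andbT.
by have := set11 z; rewrite -ez inE => /andP[].
Qed.

(** Two members err at most once each on [E], so both agree with [C] on at least [t + 2 - 2] common
    coordinates. *)
Lemma frankl_family_nontrivial r n t (C : vec r n) (E : {set 'I_r}) :
  1 < n -> 0 < t -> #|E| = t + 2 -> nontrivial_t_intersecting t (frankl_family C E).
Proof.
move=> n1 t0 cE; apply/andP; split; last first.
  rewrite (bigcapF_ball (C := C) n1) ?cards0 // => A z Az.
  rewrite frankl_family_card_agree -(cardsID (agree A C) E) -addn1 leq_add2l.
  rewrite -(cards1 z); apply/subset_leq_card/(subset_trans _ Az).
  by rewrite setDE subsetIr.
apply/forallP => A; apply/implyP; rewrite frankl_family_card_agree => AF.
apply/forallP => B; apply/implyP; rewrite frankl_family_card_agree => BF.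
apply: leq_trans (subset_leq_card (agreeI A B C)).
apply: leq_trans (subset_leq_card (subsetIr E _)).
have := cardsUI (E :&: agree A C) (E :&: agree B C).
rewrite setIACA setIid -setIUr.
have := subset_leq_card (subsetIl E (agree A C :|: agree B C)); lia.
Qed.

(** Two members of the first kind share [D]. In a mixed pair, the coordinate of [D] lost by one
    member is made up by a coordinate outside [D] where the other agrees with [C]. Two of the second
    kind lose at most two coordinates of [C], and [t + 2 <= r]. *)
Lemma hm_family_nontrivial r n t (C : vec r n) (D : {set 'I_r}) :
  1 < n -> 0 < t -> t + 2 <= r -> #|D| = t ->
  nontrivial_t_intersecting t (hm_family C D).
Proof.
move=> n1 t0 tr cD.
have cDC : 1 < #|~: D| by have := cardsC D; rewrite card_ord; lia.
apply/andP; split; last first.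
  rewrite (bigcapF_ball (C := C) n1) ?cards0 // => A z Az.
  have [e|nA] := eqVneq (~: agree A C) [set z]; last first.
    have e : agree A C = setT.
      apply: setC_inj; rewrite setCT; apply/eqP; move: Az nA.
      by rewrite subset1 => /orP[->|].
    by rewrite inE [A \in [set _ | _]]inE e subsetT setIT -card_gt0 (ltnW cDC).
  rewrite inE [A \in [set _ | _]]inE; have [zD|zD] := boolP (z \in D).
    apply/orP; right; rewrite inE; apply/existsP; exists z.
    by rewrite zD setTD e eqxx.
  (* At least two coordinates lie outside [D], so one other than [z] still agrees with [C]. *)
  have {}e : agree A C = [set~ z] by rewrite -[LHS]setCK e.
  rewrite e -disjoints_subset disjoint_sym disjoints1 zD -card_gt0 /=.
  by apply/orP; left; move: cDC; rewrite -setDE (cardsD1 z) [z \in _]inE zD.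
have sub1 A : A \in hm_family C D ->
    ((D \subset agree A C) /\ exists2 l, l \notin D & l \in agree A C) \/
    (exists2 z, z \in D & setT :\ z \subset agree A C).
  rewrite inE => /orP[|/one_diff_subP]; last by right.
  rewrite inE => /andP[DA /set0Pn[l]]; rewrite inE inE => /andP[lD lA].
  by left; split=> //; exists l.
have mixed (A B : vec r n) : (D \subset agree A C) -> (exists2 l, l \notin D & l \in agree A C) ->
    (exists2 z, z \in D & setT :\ z \subset agree B C) -> t <= #|agree A C :&: agree B C|.
  move=> DA [l lD lA] [z zD zB].
  have <- : #|l |: (D :\ z)| = t.
    by rewrite cardsU1 !inE (negbTE lD) andbF; have := cardsD1 z D; rewrite zD cD; lia.
  apply: subset_leq_card; rewrite subsetI; apply/andP; split.
    rewrite subUset sub1set lA /=; apply: subset_trans DA; exact: subsetDl.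
  apply: subset_trans zB; apply/subsetP => x; rewrite !inE andbT.
  by case/orP => [/eqP ->|/andP[]//]; apply: contraNneq lD => ->.
apply/forallP => A; apply/implyP => /sub1 AF.
apply/forallP => B; apply/implyP => /sub1 BF.
apply: leq_trans (subset_leq_card (agreeI A B C)).
case: AF BF => [[DA lA]|[y yD yA]] [[DB lB]|[z zD zB]].
- by rewrite -cD; apply: subset_leq_card; rewrite subsetI DA.
- by apply: mixed => //; exists z.
- by rewrite setIC; apply: mixed => //; exists y.
have := subset_leq_card zB; have := subset_leq_card yA.
have := cardsUI (agree A C) (agree B C).
have := subset_leq_card (subsetT (agree A C :|: agree B C)).
have := cardsD1 y [set: 'I_r]; have := cardsD1 z [set: 'I_r].
rewrite !inE !cardsT card_ord; lia.
Qed.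

Lemma exists_set_card r m : m <= r -> exists D : {set 'I_r}, #|D| = m.
Proof.
move=> mr; exists [set widen_ord mr i | i : 'I_m].
by rewrite card_imset ?card_ord // => i j /(congr1 val) /= /val_inj.
Qed.

Lemma iota0_lower r n t : 1 < n -> 0 < t -> t + 2 <= r ->
  maxn (n ^ (r - t) - (n - 1) ^ (r - t) + t * (n - 1))
       ((t + 2) * n ^ (r - t - 1) - (t + 1) * n ^ (r - t - 2)) <= iota0 t n r.
Proof.
move=> n1 t0 tr; pose C : vec r n := [ffun => Ordinal (ltnW n1)].
have [D cD] := exists_set_card (leq_trans (leq_addr 2 t) tr).
have [E cE] := exists_set_card tr.
rewrite geq_max; apply/andP; split.
  apply: (bigmax_sup (hm_family C D)); first exact: hm_family_nontrivial.
  by rewrite card_hm_family cD.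
apply: (bigmax_sup (frankl_family C E)); first exact: frankl_family_nontrivial.
rewrite card_frankl_family cE subnDA.
have -> : r - t - 1 = (r - t - 2).+1 by lia.
rewrite expnS; nia.
Qed.

(** * Partial vectors as sets of cells *)

Definition cells (r n : nat) (A : vec r n) : {set 'I_r * 'I_n} :=
  [set p | A p.1 == p.2].

Definition t_cover (r n t : nat) (F : {set vec r n}) (T : {set 'I_r * 'I_n}) : bool :=
  [forall B in F, t <= #|T :&: cells B|].

Definition kernels (r n t : nat) (F : {set vec r n}) : {set {set 'I_r * 'I_n}} :=
  [set T : {set 'I_r * 'I_n} | [&& #|T| == t.+1, t_cover t F T & [exists A in F, T \subset cells A]]].

Lemma in_cells r n (A : vec r n) p : (p \in cells A) = (A p.1 == p.2).
Proof. by rewrite inE. Qed.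

Lemma cells_fst_inj r n (A : vec r n) (T : {set 'I_r * 'I_n}) :
  T \subset cells A -> {in T &, injective fst}.
Proof.
move=> /subsetP TA [l v] [l' v'] /TA + /TA; rewrite !in_cells /= => /eqP <- /eqP <-.
by move=> ->.
Qed.

Lemma fst_inj_cells r n (T : {set 'I_r * 'I_n}) : 0 < n ->
  {in T &, injective fst} -> exists C : vec r n, T \subset cells C.
Proof.
move=> n0 inj.
(* Coordinates without a cell in [T] get the default value 0. *)
exists [ffun l => if [pick v | (l, v) \in T] is Some v then v else Ordinal n0].
apply/subsetP => -[l v] lvT; rewrite in_cells /= ffunE.
case: pickP => [w lwT|/(_ v)]; last by rewrite lvT.
by have [->] := inj _ _ lwT lvT erefl.
Qed.

(** Turns cell counts into coordinate counts: [fst] is injective on [T], and a cell of [T] belongs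
    to [A] exactly when [A] agrees with [C] there. *)
Lemma card_cap_cells r n (A C : vec r n) (T : {set 'I_r * 'I_n}) :
  T \subset cells C -> #|T :&: cells A| = #|fst @: T :&: agree A C|.
Proof.
move=> TC; have inj := cells_fst_inj TC.
have inj' : {in T :&: cells A &, injective fst}.
  by move=> p q; rewrite !(in_setI _ T) => /andP[pT _] /andP[qT _]; apply: inj.
rewrite -(card_in_imset inj'); apply: eq_card => l; rewrite in_setI in_agree.
apply/imsetP/andP => [[p]|[/imsetP[p pT ->] AC]].
  rewrite inE in_cells => /andP[pT pA] ->; split; first exact: imset_f.
  by move: (subsetP TC _ pT); rewrite in_cells (eqP pA) => /eqP ->.
exists p => //; rewrite inE pT in_cells (eqP AC).
by move: (subsetP TC _ pT); rewrite in_cells.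
Qed.

Lemma cells_imset r n (A : vec r n) : cells A = [set (l, A l) | l : 'I_r].
Proof.
apply/setP => -[l v]; rewrite in_cells /=; apply/eqP/imsetP => [<-|[l' _ [-> ->]]//].
by exists l.
Qed.

Lemma card_cells r n (A : vec r n) : #|cells A| = r.
Proof. by rewrite cells_imset card_imset ?card_ord // => l l' []. Qed.

Lemma fst_cells r n (A : vec r n) : fst @: cells A = setT.
Proof.
apply/setP => l; rewrite inE; apply/imsetP; exists (l, A l) => //.
by rewrite in_cells.
Qed.

Lemma card_cellsI r n (A B : vec r n) : #|cells A :&: cells B| = #|agree A B|.
Proof.
rewrite (card_cap_cells _ (subxx _)) fst_cells setTI.
by apply: eq_card => l; rewrite !in_agree eq_sym.
Qed.

(** Only an inequality, since [T] may put two values on one coordinate and then has no extension. *)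
Lemma card_extensions r n (T : {set 'I_r * 'I_n}) :
  #|[set A : vec r n | T \subset cells A]| <= n ^ (r - #|T|).
Proof.
have [C TC|H] := pickP (fun C : vec r n => T \subset cells C); last first.
  rewrite (_ : [set _ | _] = set0) ?cards0 //.
  by apply/setP => A; rewrite !inE H.
rewrite -(card_in_imset (cells_fst_inj TC)) -(card_agree_on C).
apply: subset_leq_card; apply/subsetP => A; rewrite !inE => TA.
apply/subsetP => l /imsetP[p pT ->]; rewrite in_agree.
have := subsetP TA _ pT; have := subsetP TC _ pT.
by rewrite !in_cells => /eqP -> /eqP ->.
Qed.

Lemma no_common_cells r n t (F : {set vec r n}) (T : {set 'I_r * 'I_n}) :
  nontrivial_t_intersecting t F -> t <= r -> t <= #|T| ->
  exists2 B, B \in F & ~~ (T \subset cells B).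
Proof.
move=> /andP[_ nt] tr tT.
have [/'exists_andP[B [BF BT]]|/existsPn H] :=
  boolP [exists B in F, ~~ (T \subset cells B)]; first by exists B.
have {}H B : B \in F -> T \subset cells B.
  by move=> BF; move: (H B); rewrite BF /= negbK.
(* On an empty family all [r] coordinates are vacuously common, which contradicts non-triviality
   because [t <= r]. *)
have [F0|[B BF]] := set_0Vmem F.
  suff e : bigcapF F = setT by move: nt; rewrite e cardsT card_ord ltnNge tr.
  by apply/setP => l; rewrite !inE F0; apply/forallP => A; rewrite inE.
move: nt; rewrite ltnNge => /negP[]; apply: leq_trans tT _.
rewrite -(card_in_imset (cells_fst_inj (H _ BF))); apply: subset_leq_card.
apply/subsetP => l /imsetP[p pT ->]; rewrite inE.
apply/forallP => A; apply/implyP => AF; apply/forallP => A'; apply/implyP => AF'.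
have := subsetP (H _ AF) _ pT; have := subsetP (H _ AF') _ pT.
by rewrite !in_cells => /eqP -> /eqP ->.
Qed.

Lemma leq_card_bigcup (I T : finType) (P : pred I) (S : I -> {set T}) m :
  (forall i, P i -> #|S i| <= m) -> #|\bigcup_(i | P i) S i| <= #|P| * m.
Proof.
move=> H; rewrite -sum_nat_const; elim/big_ind2: _ => [|x a y b xa yb|i Pi].
- by rewrite cards0.
- exact: leq_trans (leq_card_setU _ _) (leq_add xa yb).
- exact: H.
Qed.

(** * Branching and the bound by the number of kernels *)

Definition sporadic (r n t : nat) (F : {set vec r n}) : {set vec r n} :=
  [set A in F | [forall T in kernels t F, ~~ (T \subset cells A)]].

(* If [T] is not a t-cover, some [B] in [F] meets [T] in fewer than [t] cells,
   so each member of [F] extending [T] contains one of the at most [r] cells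
   of [B] outside [T]. *)
Lemma card_sporadic_above r n t (F : {set vec r n}) d (T : {set 'I_r * 'I_n}) :
  nontrivial_t_intersecting t F -> t <= r -> #|T| + d = t + 2 ->
  #|[set A in sporadic t F | T \subset cells A]| <= r ^ d * n ^ (r - t - 2).
Proof.
move=> nt tr; elim: d T => [|d IH] T.
  rewrite addn0 expn0 mul1n -subnDA => <-; apply: leq_trans (card_extensions T).
  by apply: subset_leq_card; apply/subsetP => A; rewrite !inE => /andP[].
move=> cT; have cT1 : #|T| <= t.+1 by lia.
(* A t-cover of at most [t + 1] cells has no sporadic extension: with [t + 1] cells it would be a
   kernel, and with fewer it would lie in every member of [F]. *)
have [cov|] := boolP (t_cover t F T).
  rewrite (_ : [set _ in _ | _] = set0) ?cards0 //; apply/setP => A.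
  rewrite 2!inE [_ \in set0]inE; apply/negbTE/negP => /andP[/andP[AF /forallP/(_ T) sp] TA].
  move: sp; rewrite TA implybF inE cov /= => /negP[]; apply/andP; split; last first.
    by apply/existsP; exists A; rewrite AF.
  rewrite eqn_leq; apply/andP; split; first exact: cT1.
  rewrite ltnNge; apply/negP => leT.
  have covE B : B \in F -> t <= #|T :&: cells B|.
    by move=> BF; move/forallP: cov => /(_ B); rewrite BF.
  have tT : t <= #|T|.
    exact: leq_trans (covE _ AF) (subset_leq_card (subsetIl _ _)).
  have [B BF /negP[]] := no_common_cells nt tr tT.
  apply/setIidPl/eqP; rewrite eqEcard subsetIl; exact: leq_trans leT (covE _ BF).
rewrite negb_forall => /existsP[B]; rewrite negb_imply -ltnNge => /andP[BF TB].
apply: (@leq_trans #|\bigcup_(l | (l, B l) \notin T)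
   [set A in sporadic t F | (l, B l) |: T \subset cells A]|).
  apply: subset_leq_card; apply/subsetP => A; rewrite inE => /andP[As TA].
  have AF : A \in F by move: As; rewrite inE => /andP[].
  have tAB : t <= #|cells A :&: cells B|.
    case/andP: nt => /forallP/(_ A); rewrite AF => /forallP/(_ B).
    by rewrite BF card_cellsI.
  have : ~~ (cells A :&: cells B \subset T :&: cells B).
    by apply: contraTN TB => /subset_leq_card h; rewrite -leqNgt (leq_trans tAB).
  case/subsetPn => -[l v]; rewrite !inE /= => /andP[/eqP Al /eqP Bl].
  rewrite Bl eqxx andbT => lT; apply/bigcupP; exists l; first by rewrite Bl.
  by rewrite inE As subUset sub1set in_cells /= Al Bl eqxx TA.
apply: leq_trans (leq_card_bigcup (m := r ^ d * n ^ (r - t - 2)) _) _.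
  by move=> l lT; apply: IH; rewrite cardsU1 lT -cT; lia.
by rewrite expnS -mulnA leq_mul2r -[X in _ <= X](card_ord r) max_card orbT.
Qed.

(** Branching from the empty set accounts for the second term; the extensions of each kernel, which
    fixes [t + 1] coordinates, account for the first. *)
Lemma card_le_kernels r n t (F : {set vec r n}) :
  nontrivial_t_intersecting t F -> t <= r ->
  #|F| <= #|kernels t F| * n ^ (r - t - 1) + r ^ (t + 2) * n ^ (r - t - 2).
Proof.
move=> nt tr.
have := card_sporadic_above (d := t + 2) (T := set0) nt tr.
rewrite cards0 => /(_ erefl) h; rewrite addnC.
apply: leq_trans (leq_add h (leqnn _)).
apply: (@leq_trans #|[set A in sporadic t F | set0 \subset cells A] :|:
   \bigcup_(T in kernels t F) [set A | T \subset cells A]|).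
  apply: subset_leq_card; apply/subsetP => A AF; rewrite !inE sub0set AF andbT.
  case: (boolP [forall T in _, _]) => //= /forallPn[T].
  rewrite negb_imply negbK => /andP[TG TA]; apply/bigcupP; exists T => //.
  by rewrite inE.
apply: leq_trans (leq_card_setU _ _) _; rewrite leq_add2l.
apply: leq_card_bigcup => T; rewrite inE => /andP[/eqP cT _].
by rewrite -subnDA addn1 -cT; exact: card_extensions.
Qed.

(** * Structure of the kernels of a saturated family *)

Definition saturated (r n t : nat) (F : {set vec r n}) : Prop :=
  forall A, (forall B, B \in F -> t <= #|agree A B|) -> A \in F.

Lemma kernelsP r n t (F : {set vec r n}) (T : {set 'I_r * 'I_n}) :
  T \in kernels t F ->
  [/\ #|T| = t.+1, forall B, B \in F -> t <= #|T :&: cells B|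
    & exists2 A, A \in F & T \subset cells A].
Proof.
rewrite inE => /and3P[/eqP cT /forallP cov /existsP[A /andP[AF TA]]]; split=> //.
  by move=> B BF; have := cov B; rewrite BF.
by exists A.
Qed.

(* Since all extensions of a kernel lie in [F], one of them avoids the
   cells of the other kernel outside the common part. *)
Lemma kernels_intersect r n t (F : {set vec r n}) (T T' : {set 'I_r * 'I_n}) :
  saturated t F -> 1 < n -> T \in kernels t F -> T' \in kernels t F ->
  t <= #|T :&: T'|.
Proof.
move=> sat n1 /kernelsP[_ cov [B _ TB]] /kernelsP[_ cov' [B' _ TB']].
(* Two distinct values are enough to differ from [B] at every coordinate not fixed by [T']. *)
pose o : 'I_n := Ordinal (ltnW n1); pose i : 'I_n := Ordinal n1.
pose A : vec r n := [ffun l => if (l, B' l) \in T' then B' l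
                               else if B l == o then i else o].
have TA' : T' \subset cells A.
  apply/subsetP => -[l v] lT; have := subsetP TB' _ lT.
  by rewrite !in_cells /= ffunE => /eqP e; rewrite e lT.
have AF : A \in F.
  apply: sat => D DF; rewrite -card_cellsI.
  exact: leq_trans (cov' _ DF) (subset_leq_card (setSI _ TA')).
apply: leq_trans (cov _ AF) (subset_leq_card _).
apply/subsetP => -[l v]; rewrite !in_setI => /andP[lT].
rewrite lT in_cells /= ffunE; have := subsetP TB _ lT; rewrite in_cells /= => /eqP <-.
case: ifP => [+ /eqP <- //|_].
by case: (eqVneq (B l) o) => [-> //|/negbTE]; rewrite eq_sym => ->.
Qed.

Lemma card_kernelsI r n t (F : {set vec r n}) (T1 T2 : {set 'I_r * 'I_n}) :
  saturated t F -> 1 < n -> T1 \in kernels t F -> T2 \in kernels t F ->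
  T1 != T2 -> #|T1 :&: T2| = t.
Proof.
move=> sat n1 G1 G2 T12; have i12 := kernels_intersect sat n1 G1 G2.
have [c1 _ _] := kernelsP G1; have [c2 _ _] := kernelsP G2.
apply/eqP; rewrite eqn_leq i12 andbT -ltnS ltn_neqAle -{2}c1.
rewrite (subset_leq_card (subsetIl _ _)) andbT; apply: contra T12 => /eqP e.
have /eqP <- : T1 :&: T2 == T1 by rewrite eqEcard subsetIl e c1 leqnn.
by rewrite eqEcard subsetIr e c2 leqnn.
Qed.

(** The union [S] of [T1] and [T2] has [t + 2] cells and contains [T3]. A member meeting [S] in only
    [t] cells would have all of them in each of the three kernels, whose common part is smaller than
    [t]. *)
Lemma sub_frankl_family r n t (F : {set vec r n}) (T1 T2 T3 : {set 'I_r * 'I_n}) :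
  saturated t F -> 1 < n ->
  T1 \in kernels t F -> T2 \in kernels t F -> T3 \in kernels t F ->
  T1 != T2 -> ~~ (T1 :&: T2 \subset T3) ->
  exists C : vec r n, exists2 E : {set 'I_r}, #|E| = t + 2 & F \subset frankl_family C E.
Proof.
move=> sat n1 G1 G2 G3 T12 nT3.
have [c1 cov1 [A1 _ TA1]] := kernelsP G1.
have [c2 cov2 [A2 _ TA2]] := kernelsP G2.
have [c3 cov3 [A3 _ TA3]] := kernelsP G3.
have i31 := kernels_intersect sat n1 G3 G1.
have i32 := kernels_intersect sat n1 G3 G2.
have cK := card_kernelsI sat n1 G1 G2 T12.
have cK3 : #|T1 :&: T2 :&: T3| < t.
  by rewrite -[X in _ < X]cK; apply: proper_card; rewrite properE subsetIl subsetI subxx.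
pose S := T1 :|: T2.
have cS : #|S| = t + 2 by have := cardsUI T1 T2; rewrite -/S cK c1 c2; lia.
(* [T3] meets [T1] and [T2] in at least [t] cells each, and fewer than [t] of these are counted
   twice, so [S] contains at least [t + 1] cells of [T3]. *)
have T3S : T3 \subset S.
  apply/setIidPl/eqP; rewrite eqEcard subsetIl c3.
  have := cardsUI (T3 :&: T1) (T3 :&: T2).
  rewrite -setIUr -/S setIACA setIid [T3 :&: (T1 :&: T2)]setIC; lia.
(* If [T3] missed [p], its at least [t] cells in [P] would be all of [T1 :&: T2], against [nT3]. *)
have in3 (P Q : {set 'I_r * 'I_n}) p : P :&: Q = T1 :&: T2 -> #|P| = t.+1 -> t <= #|T3 :&: P| ->
    p \in P -> p \notin Q -> p \in T3.
  move=> PQ cP i pP pQ; apply/negPn/negP => pT; move/negP: nT3; apply.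
  have sub : T3 :&: P \subset T1 :&: T2.
    have <- : P :\ p = T1 :&: T2.
      apply/eqP; rewrite eq_sym eqEcard cK -PQ; apply/andP; split; last first.
        by have := cardsD1 p P; rewrite pP cP; lia.
      apply/subsetP => x; rewrite !inE => /andP[-> xQ]; rewrite andbT.
      by apply: contraNneq pQ => <-.
    apply/subsetP => x; rewrite !inE => /andP[xT ->]; rewrite andbT.
    by apply: contraNneq pT => <-.
  have /eqP <- : T3 :&: P == T1 :&: T2 by rewrite eqEcard sub cK.
  exact: subsetIl.
(* Any two cells of [S] lie together in one of the three kernels, hence in one vector. *)
have inj : {in S &, injective fst}.
  have inj1 := cells_fst_inj TA1; have inj2 := cells_fst_inj TA2.
  have inj3 := cells_fst_inj TA3.
  have inT1 p : p \in T1 -> p \notin T2 -> p \in T3 by apply: in3.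
  have inT2 p : p \in T2 -> p \notin T1 -> p \in T3 by apply: in3 => //; rewrite setIC.
  move=> p q; rewrite !in_setU => pS qS.
  have [p1|p1] := boolP (p \in T1); have [q1|q1] := boolP (q \in T1).
  - exact: inj1.
  - have q2 : q \in T2 by move: qS; rewrite (negbTE q1).
    have [p2|p2] := boolP (p \in T2); first exact: inj2.
    by apply: inj3; [apply: inT1|apply: inT2].
  - have p2 : p \in T2 by move: pS; rewrite (negbTE p1).
    have [q2|q2] := boolP (q \in T2); first exact: inj2.
    by apply: inj3; [apply: inT2|apply: inT1].
  - by apply: inj2; [move: pS|move: qS]; rewrite ?(negbTE p1) ?(negbTE q1).
have [C SC] := fst_inj_cells (ltnW n1) inj.
exists C, (fst @: S); first by rewrite card_in_imset.
apply/subsetP => A AF; rewrite frankl_family_card_agree card_in_imset //.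
rewrite -(card_cap_cells A SC) cS addn2 !ltnS ltnNge; apply/negP => le.
have absorb (T : {set 'I_r * 'I_n}) : T \subset S -> t <= #|T :&: cells A| -> S :&: cells A \subset T.
  move=> TS tT; have /eqP <- : T :&: cells A == S :&: cells A.
    by rewrite eqEcard setSI // (leq_trans le).
  exact: subsetIl.
have sub : S :&: cells A \subset T1 :&: T2 :&: T3.
  by rewrite !subsetI !absorb ?cov1 ?cov2 ?cov3 ?subsetUl ?subsetUr.
have := leq_ltn_trans (subset_leq_card sub) cK3; rewrite ltnNge => /negP[].
exact: leq_trans (cov1 _ AF) (subset_leq_card (setSI _ (subsetUl _ _))).
Qed.

(** Each kernel is [K] plus one cell. A member not containing [K] misses just one cell of each
    kernel, and that cell is in [K]; so it contains all the added cells, which number at least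
    [r - t] and complete [K] to a full vector. *)
Lemma sub_hm_family r n t (F : {set vec r n}) (K : {set 'I_r * 'I_n}) :
  nontrivial_t_intersecting t F -> 0 < n -> t < r -> #|K| = t ->
  (forall T, T \in kernels t F -> K \subset T) -> r - t <= #|kernels t F| ->
  exists C : vec r n, exists2 D : {set 'I_r}, #|D| = t & F \subset hm_family C D.
Proof.
move=> nt n0 tr cK KT cG; pose U := cover (kernels t F).
have [B0 B0F KB0] : exists2 B, B \in F & ~~ (K \subset cells B).
  by apply: no_common_cells nt _ _; rewrite ?cK // ltnW.
have off (B : vec r n) T : B \in F -> ~~ (K \subset cells B) -> T \in kernels t F ->
    T :\: cells B = K :\: cells B /\ #|K :\: cells B| = 1.
  move=> BF KB TG; have [cT cov _] := kernelsP TG.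
  have sub : K :\: cells B \subset T :\: cells B by rewrite setSD ?KT.
  have le1 : #|T :\: cells B| <= 1.
    by have := cardsID (cells B) T; have := cov _ BF; rewrite cT; lia.
  have ge1 : 0 < #|K :\: cells B| by rewrite card_gt0 setD_eq0.
  have /eqP e : K :\: cells B == T :\: cells B.
    by rewrite eqEcard sub (leq_trans le1).
  by split=> //; apply/eqP; rewrite eqn_leq ge1 e le1.
have offU (B : vec r n) p : B \in F -> ~~ (K \subset cells B) -> p \in U -> p \notin K -> p \in cells B.
  move=> BF KB /bigcupP[T TG pT] pK; apply/negPn/negP => pB.
  have [e _] := off _ _ BF KB TG; have : p \in T :\: cells B by rewrite inE pB.
  by rewrite e inE (negbTE pK) andbF.
have [T0 T0G] : exists T, T \in kernels t F.
  by apply/set0Pn; rewrite -card_gt0; apply: leq_trans cG; rewrite subn_gt0.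
have KU : K \subset U by apply: subset_trans (KT _ T0G) (bigcup_sup _ T0G).
(* If one of the two cells is in [K], both lie in one kernel; otherwise both lie in [B0]. *)
have inj : {in U &, injective fst}.
  move=> p q pU qU; have [T TG pT] := bigcupP pU; have [T' TG' qT'] := bigcupP qU.
  have [_ _ [A _ TA]] := kernelsP TG; have [_ _ [A' _ TA']] := kernelsP TG'.
  have [pK|pK] := boolP (p \in K).
    by apply: (cells_fst_inj TA') => //; apply: subsetP (KT _ TG') _ pK.
  have [qK|qK] := boolP (q \in K).
    by apply: (cells_fst_inj TA) => //; apply: subsetP (KT _ TG) _ qK.
  by apply: (cells_fst_inj (subxx (cells B0))); apply: offU.
have [C UC] := fst_inj_cells n0 inj.
(* A kernel is determined by its cell outside [K], so [U] has at least [t + (r - t)] cells. *)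
have {UC} eU : U = cells C.
  apply/eqP; rewrite eqEcard UC card_cells.
  have : #|kernels t F| <= #|U :\: K|.
    apply: leq_trans (leq_imset_card (fun x => x |: K) _).
    apply: subset_leq_card; apply/subsetP => T TG; have [cT _ _] := kernelsP TG.
    have : #|T :\: K| == 1 by rewrite cardsD (setIidPr (KT _ TG)) cT cK subSnn.
    move=> /cards1P[x ex]; have xT : x \in T :\: K by rewrite ex set11.
    apply/imsetP; exists x.
      move: xT; rewrite !inE => /andP[-> xT] /=; apply/bigcupP; by exists T.
    by rewrite -ex setUC -{1}(setID T K) (setIidPr (KT _ TG)).
  rewrite cardsD (setIidPr KU) cK; lia.
have KC : K \subset cells C by rewrite -eU.
have cellC l : (l, C l) \in U by rewrite eU in_cells.
exists C, (fst @: K); first by rewrite (card_in_imset (cells_fst_inj KC)).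
apply/subsetP => B BF; rewrite inE; apply/orP.
have [KB|KB] := boolP (K \subset cells B); [left|right].
  rewrite inE; apply/andP; split.
    apply/subsetP => l /imsetP[p pK ->]; rewrite in_agree.
    have := subsetP KB _ pK; have := subsetP KC _ pK.
    by rewrite !in_cells => /eqP -> /eqP ->.
  (* [B] and [B0] share at least [t] cells, but [B0] contains only [t - 1] cells of [K]; a shared
     cell outside [K] is a cell of [C], since [B0] follows [C] off [K]. *)
  have : ~~ (cells B :&: cells B0 \subset K :&: cells B0).
    apply/negP => /subset_leq_card; rewrite card_cellsI.
    have [_ k1] := off _ _ B0F KB0 T0G.
    have := cardsID (cells B0) K; rewrite k1 cK.
    case/andP: nt => /forallP/(_ B); rewrite BF => /forallP/(_ B0); rewrite B0F /=.
    lia.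
  case/subsetPn => p; rewrite !in_setI => /andP[pB pB0]; rewrite pB0 andbT => pK.
  have pD : p.1 \notin fst @: K.
    apply: contra pK => /imsetP[q qK e].
    by rewrite (cells_fst_inj (subxx (cells B)) pB (subsetP KB _ qK) e).
  apply/set0Pn; exists p.1; rewrite in_setI in_setC pD in_agree.
  have : (p.1, C p.1) \in cells B0.
    by apply: offU => //; apply: contra pD => h; apply/imsetP; exists (p.1, C p.1).
  by move: pB pB0; rewrite !in_cells /= => /eqP -> /eqP ->; rewrite eq_sym.
(* The unique cell [q] of [K] missed by [B] is its only deviation from [C]. *)
have [_ /eqP/cards1P[q eq]] := off _ _ BF KB T0G.
have : q \in K :\: cells B by rewrite eq set11.
rewrite inE => /andP[qB qK]; rewrite inE; apply/existsP; exists q.1.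
rewrite imset_f //=; apply/eqP/setP => l; rewrite !inE andbT; apply/idP/eqP => [lB|->].
  have lnB : (l, C l) \notin cells B by rewrite in_cells.
  have lK : (l, C l) \in K by apply: contraNT lnB => h; apply: offU.
  have : (l, C l) \in K :\: cells B by rewrite inE lnB lK.
  by rewrite eq inE => /eqP <-.
by move: qB (subsetP KC _ qK); rewrite !in_cells => qB /eqP ->.
Qed.

(** * Estimates for large [n] and the upper bound *)

(** Second-order truncation of the binomial expansion of [(x - 1) ^ k.+2] at [x = m.+1]. The
    quadratic coefficient is doubled to avoid halves, and the terms are arranged to avoid
    subtraction. *)
Lemma expn_sub1_upper m k :
  m ^ k.+2 + k.+2 * m.+1 ^ k.+1 <= m.+1 ^ k.+2 + k.+2 * k.+1 * m.+1 ^ k.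
Proof.
elim: k => [|k IH]; first by rewrite !expnS !expn0; nia.
have {IH} : m * (m ^ k.+2 + k.+2 * m.+1 ^ k.+1) <=
            m * (m.+1 ^ k.+2 + k.+2 * k.+1 * m.+1 ^ k) by rewrite leq_mul2l IH orbT.
rewrite [m ^ k.+3]expnS !(expnS m.+1).
by move: (m ^ k.+2) (m.+1 ^ k) => x y; nia.
Qed.

(** Positivity ensures that a non-trivial family exists. Adding a vector that agrees enough with all
    members keeps a largest one admissible, as common coordinates can only disappear; [t <= r]
    covers the agreement of the new vector with itself. *)
Lemma iota0_attained r n t : 0 < iota0 t n r ->
  exists F : {set vec r n},
    [/\ nontrivial_t_intersecting t F, #|F| = iota0 t n r
      & t <= r -> saturated t F].
Proof.
move=> i0; have [H|H] := pickP (fun F : {set vec r n} => nontrivial_t_intersecting t F); last first.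
  by move: i0; rewrite /iota0 big_pred0.
move=> hH; have [|F ntF eF] := eq_bigmax_cond (A := @nontrivial_t_intersecting r n t) (fun F => #|F|).
  by apply/card_gt0P; exists H.
have ntF' : nontrivial_t_intersecting t F := ntF.
exists F; split=> // tr A HA; have [ti ci] := andP ntF'.
have ntA : nontrivial_t_intersecting t (A |: F).
  have tiF B B' : B \in F -> B' \in F -> t <= #|agree B B'|.
    by move=> BF BF'; move/forallP: ti => /(_ B); rewrite BF => /forallP/(_ B'); rewrite BF'.
  have sym B B' : agree B B' = agree B' B :> {set 'I_r}.
    by apply/setP => l; rewrite !in_agree eq_sym.
  apply/andP; split.
    apply/forallP => B; apply/implyP => BF; apply/forallP => B'; apply/implyP => BF'.
    case/setU1P: BF => [->|BF]; case/setU1P: BF' => [->|BF'].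
    - suff -> : agree A A = setT by rewrite cardsT card_ord.
      by apply/setP => l; rewrite in_agree eqxx inE.
    - exact: HA.
    - by rewrite sym; apply: HA.
    - exact: tiF.
  apply: leq_ltn_trans ci; apply: subset_leq_card; apply/subsetP => l.
  rewrite !inE => /forallP h; apply/forallP => B; apply/implyP => BF.
  apply/forallP => B'; apply/implyP => BF'; move: (h B); rewrite !inE BF orbT.
  by move=> /forallP/(_ B'); rewrite !inE BF' orbT.
have : #|A |: F| <= #|F|.
  by rewrite -eF; apply: (@leq_bigmax_cond _ (mem (@nontrivial_t_intersecting r n t)) (fun F => #|F|)).
by rewrite cardsU1; case: (A \in F); rewrite // add1n ltnn.
Qed.

(** The difference of powers is at least [k.+2 * n ^ k.+1] up to an error of order [n ^ k]; as
    [g <= k.+1], one spare [n ^ k.+1] absorbs all lower-order terms. *)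
Lemma few_kernels_bound n k g c : g <= k.+1 -> c + k.+2 * k.+1 <= n ->
  g * n ^ k.+1 + c * n ^ k <= n ^ k.+2 - (n - 1) ^ k.+2.
Proof.
case: n => [|m] gk cn; first by lia.
rewrite subn1 /= leq_subRL; last by rewrite leq_exp2r.
have := expn_sub1_upper m k; have : (c + k.+2 * k.+1) * m.+1 ^ k <= m.+1 * m.+1 ^ k.
  by rewrite leq_mul2r cn orbT.
have : g * m.+1 ^ k.+1 <= k.+1 * m.+1 ^ k.+1 by rewrite leq_mul2r gk orbT.
rewrite [m.+1 ^ k.+2]expnS -expnS.
by move: (m ^ k.+2) (m.+1 ^ k.+1) (m.+1 ^ k) => x p y; nia.
Qed.

(** In the threshold, [r ^ (t + 2)] is the branching constant, [r * r] dominates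
    [(r - t) * (r - t - 1)], and 2 gives [1 < n]. *)
Lemma iota0_upper r n t : 0 < t -> t + 2 <= r -> r ^ (t + 2) + r * r + 2 <= n ->
  iota0 t n r <= maxn (n ^ (r - t) - (n - 1) ^ (r - t) + t * (n - 1))
                      ((t + 2) * n ^ (r - t - 1) - (t + 1) * n ^ (r - t - 2)).
Proof.
move=> t0 tr nbig; have n1 : 1 < n by lia.
have tr1 : t <= r by lia.
have [->//|] := posnP (iota0 t n r).
move=> /iota0_attained[F [nt <- /(_ tr1) sat]]; rewrite leq_max.
have [few|many] := ltnP #|kernels t F| (r - t).
  apply/orP; left; apply: leq_trans (card_le_kernels nt tr1) _.
  apply: leq_trans (leq_addr _ _).
  have [k ek] : exists k, r - t = k.+2 by exists (r - t - 2); lia.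
  rewrite ek (_ : k.+2 - 1 = k.+1) 1?(_ : k.+2 - 2 = k); try lia.
  apply: few_kernels_bound; first by lia.
  have : k.+2 * k.+1 <= r * r by apply: leq_mul; lia.
  by lia.
(* Two distinct kernels exist because [r - t] is at least 2; their intersection is the candidate
   common core. *)
have [T1 [T2 [G1 G2 T12]]] : exists T1 T2, [/\ T1 \in kernels t F, T2 \in kernels t F & T1 != T2].
  by have /card_gt1P[T1 [T2 [? ? ?]]] : 1 < #|kernels t F| by [lia]; exists T1, T2.
have [/existsP[T3 /andP[G3 nT3]]|/existsPn sunflower] :=
  boolP [exists T3 in kernels t F, ~~ (T1 :&: T2 \subset T3)].
  have [C [E cE FE]] := sub_frankl_family sat n1 G1 G2 G3 T12 nT3.
  apply/orP; right; apply: leq_trans (subset_leq_card FE) _.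
  rewrite card_frankl_family cE subnDA (_ : r - t - 1 = (r - t - 2).+1); last by lia.
  by rewrite expnS; move: (n ^ _) => x; nia.
apply/orP; left.
have KT T : T \in kernels t F -> T1 :&: T2 \subset T.
  by move=> TG; have := sunflower T; rewrite TG /= negbK.
have cK := card_kernelsI sat n1 G1 G2 T12.
have [C [D cD FD]] := sub_hm_family nt (ltnW n1) (ltac:(lia) : t < r) cK KT many.
by apply: leq_trans (subset_leq_card FD) _; rewrite card_hm_family cD.
Qed.

Theorem theorem1p5 (r t : nat) :
  3 <= r -> 1 <= t -> t <= r - 2 ->
  exists n0 : nat, forall n : nat, n0 <= n ->
    iota0 t n r =
    maxn (n ^ (r - t) - (n - 1) ^ (r - t) + t * (n - 1))
         ((t + 2) * n ^ (r - t - 1) - (t + 1) * n ^ (r - t - 2)).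
Proof.
move=> r3 t1 tr; exists (r ^ (t + 2) + r * r + 2) => n nbig.
have tr2 : t + 2 <= r by lia.
by apply/eqP; rewrite eqn_leq iota0_upper // iota0_lower //; lia.
Qed.
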